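(* For every integer $m\ge1$, the rational number $c_m=\frac{(-1)^{m-1}}{2m}\sum_{k=1}^{m}\frac{k\,S_m^{(k)}}{(k+2)(k+1)}$ satisfies $$c_m=\frac1m\int_0^1\left(u-\tfrac12\right)u\prod_{k=1}^{m-1}(k-u)\,du .$$ Moreover, all coefficients $c_m$ except the first two are negative, i.e. $c_m<0$ for all $m>2$.
   Context: $S_m^{(k)}$ denotes the (signed) Stirling number of the first kind, defined by $\prod_{k=0}^{m-1}(x-k)=\sum_{k=0}^{m}S_m^{(k)}x^k$. Empty products equal $1$. The numbers $c_m$ are the coefficients of Binet's second factorial series $\mu(z)=\sum_{m\ge1}c_m/\prod_{k=0}^{m-1}(z+k)$, $\operatorname{Re}(z)>0$, of Binet's function $\mu(z)=\log\Gamma(z)-(z-\frac12)\log z+z-\frac12\log(2\pi)$. *)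

(* Defs.v *)
From HB Require Import structures.
From mathcomp Require Import all_boot all_order all_algebra.

Set Implicit Arguments.
Unset Strict Implicit.
Unset Printing Implicit Defensive.

Import Order.TTheory GRing.Theory Num.Theory.

Local Open Scope ring_scope.

Definition stirling1 (m k : nat) : int :=
  (\prod_(i < m) ('X - (i%:Z)%:P))`_k.

(* Coefficient of 1 / (z (z + 1) ... (z + m - 1)) in Binet's second factorial
   series for log Gamma, given here by its closed form; meaningful for 0 < m. *)
Definition binet_coef (m : nat) : rat :=
  (-1) ^+ m.-1 / (2 * m%:R) *
  \sum_(1 <= k < m.+1) (k%:R * (stirling1 m k)%:~R) / (k.+2%:R * k.+1%:R).

(* Main.v *)
(** The integrand is [(-1)^(m-1) (u - 1/2)] times the falling factorial
    [u (u - 1) ... (u - m + 1)], whose coefficients are the Stirling numbers, and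
    [\int_0^1 (u - 1/2) u^k du = k / (2 (k + 1) (k + 2))]; this is the formula.
    For the sign, let [h u = \prod_(3 <= k < m) (k - u)].  It is positive and
    nonincreasing on [[0, 1]], so [(u - 1/2) h u <= (u - 1/2) h (1/2)] there, whence
    [m c_m <= h (1/2) * (3 c_3)], and [3 c_3 = - 1 / 120]. *)
Require Import Defs.
From HB Require Import structures.
From mathcomp Require Import all_boot all_order all_algebra.
From mathcomp Require Import all_classical all_reals all_analysis.
From mathcomp Require Import ring lra.

Set Implicit Arguments.
Unset Strict Implicit.
Unset Printing Implicit Defensive.

Import Order.TTheory GRing.Theory Num.Theory.
Import numFieldNormedType.Exports.

Local Open Scope classical_set_scope.
Local Open Scope ring_scope.

Lemma integrable_horner (R : realType) (p : {poly R}) (a b : R) :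
  (@lebesgue_measure R).-integrable `[a, b] (EFin \o horner p).
Proof.
apply: continuous_compact_integrable; first exact: segment_compact.
by apply: continuous_subspaceT => x; exact: continuous_horner.
Qed.

Lemma Rintegral_deriv_horner (R : realType) (p : {poly R}) (a b : R) : a < b ->
  \int[@lebesgue_measure R]_(x in `[a, b]) p^`().[x] = p.[b] - p.[a].
Proof.
move=> ab; rewrite /Rintegral (@continuous_FTC2 _ _ (horner p)) //.
- by apply: continuous_subspaceT => x; exact: continuous_horner.
- split=> [x _||]; first exact: derivable_horner.
  + by apply: cvg_at_right_filter; exact: continuous_horner.
  + by apply: cvg_at_left_filter; exact: continuous_horner.
- by move=> x _; rewrite derivE.
Qed.

Lemma stirling1_falling (R : comNzRingType) (m : nat) (u : R) :
  \sum_(0 <= k < m.+1) (stirling1 m k)%:~R * u ^+ k =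
  \prod_(0 <= k < m) (u - k%:R).
Proof.
pose Q : {poly int} := \prod_(i < m) ('X - (i%:Z)%:P).
(* The leading coefficient 1 stays nonzero under the cast to [R], so the degree is exactly [m] and
   [horner_coef] sums over the required range. *)
have sQ : size (map_poly intr Q : {poly R}) = m.+1.
  rewrite size_map_poly_id0 ?size_prod_XsubC -?[index_enum _]enumT ?size_enum_ord//.
  by rewrite (monicP (monic_prod_XsubC _ _ _)) oner_neq0.
rewrite !big_mkord.
transitivity (map_poly intr Q).[u].
  rewrite horner_coef sQ; apply: eq_bigr => i _.
  by rewrite coef_map.
rewrite rmorph_prod/= horner_prod; apply: eq_bigr => i _.
by rewrite rmorphB/= map_polyX map_polyC/= !hornerE.
Qed.

(** The factor for [k = 0] is [u] itself; each of the other [m - 1] factors changes sign. *)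
Lemma falling_prod (R : comNzRingType) (m : nat) (u : R) : (0 < m)%N ->
  u * \prod_(1 <= k < m) (k%:R - u) =
  (-1) ^+ m.-1 * \prod_(0 <= k < m) (u - k%:R).
Proof.
move=> m0; rewrite [in RHS]big_ltn// subr0 mulrCA; congr (_ * _).
elim: m m0 => [//|[|m] IH] _; first by rewrite !big_geq// mulr1.
by rewrite !(@big_nat_recr _ _ _ m.+1 1%N)//= IH// exprS; ring.
Qed.

(** Supplies an explicit primitive of each moment integrand, so that the moments reduce to endpoint
    values. *)
Lemma deriv_moment (R : numFieldType) (k : nat) (u : R) :
  (k.+2%:R^-1 *: 'X^(k.+2) - (2 * k.+1%:R)^-1 *: 'X^(k.+1))^`().[u] =
  (u - 2^-1) * u ^+ k.
Proof.
rewrite derivB !derivZ !derivXn hornerD hornerN !hornerZ !hornerMn !hornerXn /=.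
rewrite -[u ^+ _ *+ _]mulr_natl -[u ^+ k *+ _]mulr_natl mulKf ?pnatr_eq0//.
by rewrite invfM -mulrA mulKf ?pnatr_eq0// exprS mulrBl.
Qed.

Lemma binet_coef_integral (R : realType) (m : nat) : (0 < m)%N ->
  ratr (binet_coef m) = m%:R^-1 *
    \int[@lebesgue_measure R]_(u in `[0, 1])
      ((u - 2^-1) * u * \prod_(1 <= k < m) (k%:R - u)).
Proof.
move=> m0.
(* [P] is a primitive of the whole integrand, assembled termwise; a single use of the fundamental
   theorem then avoids exchanging sum and integral. *)
pose P : {poly R} := (-1) ^+ m.-1 *: \sum_(0 <= k < m.+1)
  (stirling1 m k)%:~R *: (k.+2%:R^-1 *: 'X^(k.+2) - (2 * k.+1%:R)^-1 *: 'X^(k.+1)).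
under eq_Rintegral => u _.
  rewrite -mulrA falling_prod// -stirling1_falling.
  have -> : (u - 2^-1) * ((-1) ^+ m.-1 *
      \sum_(0 <= k < m.+1) (stirling1 m k)%:~R * u ^+ k) = P^`().[u].
    rewrite /P derivZ hornerZ mulrCA raddf_sum/= horner_sum mulr_sumr.
    congr (_ * _); apply: eq_bigr => k _.
    by rewrite derivZ hornerZ deriv_moment mulrCA.
  over.
rewrite Rintegral_deriv_horner// /P !hornerZ !horner_sum -mulrBr -sumrB.
under eq_bigr => k _.
  have -> : forall c (q : {poly R}), (c *: q).[1] - (c *: q).[0] = c * (q.[1] - q.[0]).
    by move=> c q; rewrite !hornerZ mulrBr.
  rewrite !hornerD !hornerN !hornerZ !hornerXn !expr1n !expr0n/= !mulr0 !subr0 !mulr1.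
  have -> : (stirling1 m k)%:~R * (k.+2%:R^-1 - (2 * k.+1%:R)^-1) =
      2^-1 * (k%:R * (stirling1 m k)%:~R / (k.+2%:R * k.+1%:R)) :> R.
    move: (pnatr_eq0 R k.+1) (pnatr_eq0 R k.+2); rewrite -!natr1.
    move: (k%:R) => x /negbT x1 /negbT x2.
    by field; rewrite x1 x2.
  over.
(* The term [k = 0] vanishes through its factor [k], which leaves the range used in [binet_coef]. *)
rewrite -mulr_sumr big_ltn// !mul0r add0r.
rewrite /binet_coef rmorphM fmorph_div rmorphXn rmorphN1 rmorphM !rmorph_nat rmorph_sum/=.
rewrite invfM; under eq_bigr do rewrite fmorph_div !rmorphM/= !ratr_nat ratr_int.
by ring.
Qed.

Lemma ler_prod_subn (R : realDomainType) (i m : nat) (x y : R) :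
  x <= y -> y <= i%:R ->
  0 <= \prod_(i <= k < m) (k%:R - y) <= \prod_(i <= k < m) (k%:R - x).
Proof.
move=> xy yi; rewrite !big_nat.
have k0 k : (i <= k < m)%N -> 0 <= k%:R - y.
  by move=> /andP[ik _]; rewrite subr_ge0 (le_trans yi)// ler_nat.
rewrite prodr_ge0//=; apply: ler_prod => k /k0 -> /=.
by rewrite lerB.
Qed.

(** To the left of [a] the factor [u - a] is nonpositive while [h u] is at least [h a]; to the right
    both comparisons reverse. *)
Lemma subr_mul_antitone_le (R : realDomainType) (h : R -> R) (D : R) (a u : R) :
  a <= D -> u <= D -> {in <= D &, {homo h : x y /~ x <= y}} ->
  (u - a) * h u <= (u - a) * h a.
Proof.
move=> aD uD hD; have [ua|au] := leP u a.
  by rewrite ler_wnM2l ?subr_le0// hD.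
by rewrite ler_wpM2l ?subr_ge0 ?hD ?ltW.
Qed.

Lemma Rintegral_binet3 (R : realType) :
  \int[@lebesgue_measure R]_(u in `[0, 1])
    ((u - 2^-1) * u * (1 - u) * (2 - u)) = - 120^-1.
Proof.
(* The integrand expands to [u^4 - (7/2) u^3 + (7/2) u^2 - u]. *)
pose P : {poly R} := 5^-1 *: 'X^5 - (7 / 8) *: 'X^4 + (7 / 6) *: 'X^3 - 2^-1 *: 'X^2.
under eq_Rintegral => u _.
  have -> : (u - 2^-1) * u * (1 - u) * (2 - u) = P^`().[u].
    rewrite /P !(derivB, derivD, derivZ, derivXn, hornerE, hornerMn, hornerXn)/=.
    by field.
  over.
rewrite Rintegral_deriv_horner// /P !(hornerD, hornerN, hornerZ, hornerXn).
by rewrite !expr1n !expr0n /=; field.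
Qed.

Lemma binet_integral_lt0 (R : realType) (m : nat) : (2 < m)%N ->
  \int[@lebesgue_measure R]_(u in `[0, 1])
    ((u - 2^-1) * u * \prod_(1 <= k < m) (k%:R - u)) < 0.
Proof.
move=> m2; pose h (u : R) := \prod_(3 <= k < m) (k%:R - u).
have h0 : 0 < h 2^-1.
  rewrite /h big_nat prodr_gt0// => k /andP[k3 _].
  by rewrite subr_gt0 (@lt_le_trans _ _ 3)// ?ler_nat//; lra.
(* Writing both integrands as polynomials makes their integrability immediate. *)
pose p : {poly R} := ('X - (2^-1)%:P) * 'X * \prod_(1 <= k < m) (k%:R%:P - 'X).
pose q : {poly R} := ('X - (2^-1)%:P) * 'X * (1 - 'X) * (2%:P - 'X).
have pE u : p.[u] = (u - 2^-1) * u * \prod_(1 <= k < m) (k%:R - u).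
  rewrite /p !hornerE horner_prod; congr (_ * _).
  by apply: eq_bigr => k _; rewrite !hornerE.
have qE u : q.[u] = (u - 2^-1) * u * (1 - u) * (2 - u).
  by rewrite /q !hornerE.
apply: (@le_lt_trans _ _ (\int[@lebesgue_measure R]_(u in `[0, 1]) (h 2^-1 *: q).[u])).
  under eq_Rintegral do rewrite -pE.
  apply: le_Rintegral => //; try exact: integrable_horner.
  move=> u /=; rewrite in_itv/= => /andP[u0 u1].
  rewrite pE hornerZ qE big_ltn ?(ltn_trans _ m2)// big_ltn// -/(h u).
  have hle : (u - 2^-1) * h u <= (u - 2^-1) * h 2^-1.
    (* The bound 3 is the least [k] in [h]: up to there all its factors are nonnegative and
       decreasing. *)
    apply: (@subr_mul_antitone_le _ h 3); try lra.
    by move=> x y x3 y3 xy; have /andP[] := ler_prod_subn m xy x3.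
  (* The factors left out of [h] form a nonnegative weight that carries [hle] to the integrands. *)
  have u0' : 0 <= u * (1 - u) * (2 - u) by rewrite !mulr_ge0//; lra.
  have := ler_wpM2l u0' hle.
  by congr (_ <= _); ring.
under eq_Rintegral do rewrite hornerZ.
rewrite RintegralZl//; last exact: integrable_horner.
under eq_Rintegral do rewrite qE.
by rewrite Rintegral_binet3 pmulr_rlt0// oppr_lt0 invr_gt0.
Qed.

Theorem theorem2 (R : realType) :
  (forall m : nat, (1 <= m)%N ->
     (ratr (binet_coef m) : R) =
       m%:R^-1 *
       \int[@lebesgue_measure R]_(u in `[0, 1])
         ((u - 2^-1) * u * \prod_(1 <= k < m) (k%:R - u))) /\
  (forall m : nat, (2 < m)%N -> binet_coef m < 0).
Proof.
split=> m m0; first exact: binet_coef_integral.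
(* The embedding [ratr] reflects signs, so the rational inequality can be checked in [R]. *)
rewrite -(ltrq0 R) binet_coef_integral ?(ltn_trans _ m0)//.
by rewrite pmulr_rlt0 ?binet_integral_lt0// invr_gt0 ltr0n (ltn_trans _ m0).
Qed.
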